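(* Let $0<\sigma_-<\sigma_+$ be fixed and consider any $0\le\gamma\le0.25$. Fix any $\eta>0$ arbitrarily small (in particular $\eta\le 2/3$) and take $\Delta=\lfloor(\tfrac13+\eta)n\rfloor$. Then, for $n$ large enough, $$\rho^{*2}_{\gamma,\mathrm{var}}[0,\Delta]\ \ge\ c_\eta\,\sigma_+^2\,n^{5/6}$$ for some constant $c_\eta>0$ depending only on $\eta$.
   Context: Model: $Y_i=\theta_i+\epsilon_i$, $i=1,\dots,n$, with $\theta\in\mathbb R^n$ unknown and $\epsilon_i$ i.i.d. $\mathcal N(0,\sigma^2)$, where $\sigma$ is unknown but belongs to the known fixed interval $[\sigma_-,\sigma_+]$; $\mathbb P_{\theta,\sigma}$ is the law of $Y$. $\mathbb B_0[k]=\{\theta\in\mathbb R^n:\|\theta\|_0\le k\}$, where $\|\theta\|_0$ is the number of non-zero entries; $d_2$ is the Euclidean distance; $\mathbb B_0[k_1,k_0,\rho]=\{\theta\in\mathbb B_0[k_1]:d_2(\theta,\mathbb B_0[k_0])\ge\rho\}$. For a test $T$ (measurable $\{0,1\}$-valued function of $Y$, not depending on $\sigma$), $$R_{\mathrm{var}}(T;k_0,\Delta,\rho)=\sup_{\theta\in\mathbb B_0[k_0],\,\sigma\in[\sigma_-,\sigma_+]}\mathbb P_{\theta,\sigma}[T=1]+\sup_{\theta\in\mathbb B_0[k_0+\Delta,k_0,\rho],\,\sigma\in[\sigma_-,\sigma_+]}\mathbb P_{\theta,\sigma}[T=0],$$ $\rho_{\gamma,\mathrm{var}}(T;k_0,\Delta)=\sup\{\rho>0:R_{\mathrm{var}}(T;k_0,\Delta,\rho)>\gamma\}\in[0,\infty]$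 and $\rho^*_{\gamma,\mathrm{var}}[k_0,\Delta]=\inf_T\rho_{\gamma,\mathrm{var}}(T;k_0,\Delta)$, infimum over all tests; $\rho^{*2}_{\gamma,\mathrm{var}}$ denotes its square. ''$n$ large enough'' means larger than a threshold depending only on $\eta$ and the fixed ratio $\sigma_+/\sigma_-$. *)

(* Defs.v *)
From HB Require Import structures.
From mathcomp Require Import all_boot all_order all_algebra.
From mathcomp Require Import all_classical all_reals all_analysis.
From mathcomp Require Import measurable_realfun.

Set Implicit Arguments.
Unset Strict Implicit.
Unset Printing Implicit Defensive.

Import Order.TTheory GRing.Theory Num.Theory.
Import numFieldNormedType.Exports.

Local Open Scope classical_set_scope.
Local Open Scope ring_scope.

Section iid_law.
Context d (T : measurableType d) (R : realType) (P : probability T R).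

Definition tuple_cons n (x : T * n.-tuple T) : n.+1.-tuple T :=
  [tuple of x.1 :: x.2].

Lemma measurable_tuple_cons n : measurable_fun setT (@tuple_cons n).
Proof. exact: measurable_cons. Qed.

HB.instance Definition _ n :=
  isMeasurableFun.Build _ _ _ _ (@tuple_cons n) (@measurable_tuple_cons n).

(* The library has only binary products of measures; this is the n-fold
   product of P with itself, see iid_law_box. *)
Fixpoint iid_law n : probability (n.-tuple T) R :=
  match n with
  | 0 => \d_ [tuple]
  | n'.+1 => distribution (P \x iid_law n')%E (@tuple_cons n')
  end.

Lemma measurable_box n (A : 'I_n -> set T) : (forall i, measurable (A i)) ->
  measurable [set x : n.-tuple T | forall i, A i (tnth x i)].
Proof.
move=> mA.
rewrite (_ : [set _ | _] =
    \bigcap_(i in [set: 'I_n]) ((@tnth _ T ^~ i) @^-1` A i)).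
  apply: fin_bigcap_measurable => [|i _]; first exact: finite_finset.
  by rewrite -[X in measurable X]setTI; exact: measurable_tnth.
by apply/seteqP; split=> x /= Ax i; [move=> _; exact: Ax|exact: Ax].
Qed.

Lemma iid_law_box n (A : 'I_n -> set T) : (forall i, measurable (A i)) ->
  iid_law n [set x | forall i, A i (tnth x i)] = (\prod_(i < n) P (A i))%E.
Proof.
elim: n A => [|n IHn] A mA.
  by rewrite big_ord0 /= diracE mem_set//= => -[].
rewrite big_ord_recl -IHn//= /distribution /pushforward.
rewrite -product_measure1E//; last first.
  by apply: (@measurable_box n (fun i => A (lift ord0 i))) => i; exact: mA.
congr (product_measure1 _ _ _); apply/seteqP; split=> -[x t]/= Ax.
  split; first by have := Ax ord0; rewrite tnth0.
  by move=> i; have := Ax (lift ord0 i); rewrite tnthS.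
move=> i; case: (unliftP ord0 i) => [j|] ->; last by rewrite tnth0; case: Ax.
by rewrite tnthS; case: Ax => _; exact.
Qed.

End iid_law.

Section model.
Context (R : realType) (n : nat).
Implicit Types (theta : n.-tuple R) (sigma : R) (k : nat) (rho : R).

(* normal_prob lives on measurableTypeR R, whose sigma-algebra is convertible to
   the Borel one of R but carries another display. *)
Definition add_tuple theta (eps : n.-tuple (measurableTypeR R)) : n.-tuple R :=
  [tuple tnth theta i + tnth eps i | i < n].

Lemma measurable_add_tuple theta : measurable_fun setT (add_tuple theta).
Proof.
apply/measurable_fun_tnthP => i.
rewrite (_ : _ \o _ = fun eps => tnth theta i + tnth eps i); last first.
  by apply/funext => eps /=; rewrite tnth_mktuple.
by apply: measurable_funD => //; exact: (@measurable_tnth _ (measurableTypeR R)).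
Qed.

HB.instance Definition _ theta :=
  isMeasurableFun.Build _ _ _ _ (add_tuple theta) (@measurable_add_tuple theta).

(* Law of Y = theta + eps, with eps_i i.i.d. N(0, sigma ^+ 2); the second
   argument of normal_prob is the standard deviation. *)
Definition law_Y theta sigma : probability (n.-tuple R) R :=
  distribution (iid_law (normal_prob 0 sigma) n) (add_tuple theta).

Definition l0norm theta : nat := count (fun x => x != 0) theta.

Definition d2 theta (u : n.-tuple R) : R :=
  Num.sqrt (\sum_(i < n) (tnth theta i - tnth u i) ^+ 2).

(* A real infimum, legitimate because S is nonempty wherever this is used
   (0 belongs to every B0 k). *)
Definition d2_set theta (S : set (n.-tuple R)) : R := inf [set d2 theta u | u in S].

Definition B0 k : set (n.-tuple R) := [set theta | (l0norm theta <= k)%N].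

Definition B0_sep k1 k0 rho : set (n.-tuple R) :=
  [set theta | B0 k1 theta /\ rho <= d2_set theta (B0 k0)].

(* Supremum in [0, +oo]: the supremum of the empty set is 0, not -oo. *)
Definition nneg_sup (A : set (\bar R)) : \bar R := maxe 0%E (ereal_sup A).

Context (sigma_m sigma_p : R).

Definition sup_risk (Theta : set (n.-tuple R)) (E : set (n.-tuple R)) : \bar R :=
  nneg_sup [set law_Y p.1 p.2 E | p in Theta `*` `[sigma_m, sigma_p]].

Definition R_var (T : {mfun n.-tuple R >-> bool}) k0 Delta rho : \bar R :=
  (sup_risk (B0 k0) [set y | T y = true] +
   sup_risk (B0_sep (k0 + Delta) k0 rho) [set y | T y = false])%E.

Definition rho_var (gamma : R) (T : {mfun n.-tuple R >-> bool}) k0 Delta : \bar R :=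
  nneg_sup [set rho%:E | rho in [set rho | 0 < rho /\ (gamma%:E < R_var T k0 Delta rho)%E]].

Definition rho_star_var (gamma : R) k0 Delta : \bar R :=
  ereal_inf [set rho_var gamma T k0 Delta | T in [set: {mfun n.-tuple R >-> bool}]].

End model.

(* Main.v *)
(* Under the null, Y ~ N(0, s^2 I) with s = sigma_+.  Under the alternative, the
   means are i.i.d. from the three-point Gauss-Hermite law (mass 2/3 at 0, 1/6 at
   +a and 1/6 at -a, with a^2 = 3 x s^2) and the noise variance is (1 - x) s^2.
   The prior matches the moments of N(0, x s^2) up to order 5, so the chi-square
   divergence per coordinate is O(x^6) and with x = n^(-1/6) / 10 the n-fold
   mixture stays close to the null, while theta has about n/3 non-zero entries
   and squared norm about n x s^2. *)
From HB Require Import structures.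
Require Import Defs.
From mathcomp Require Import all_boot all_order all_algebra.
From mathcomp Require Import all_classical all_reals all_analysis.
From mathcomp Require Import measurable_realfun ring lra.

Set Implicit Arguments.
Unset Strict Implicit.
Unset Printing Implicit Defensive.

Import Order.TTheory GRing.Theory Num.Theory.
Import numFieldNormedType.Exports.

Local Open Scope classical_set_scope.
Local Open Scope ring_scope.

(** * Expansion of the chi-square divergence *)

(** The proportion 1/3 comes from the quadrature rule: a three-point law with the Gaussian moments
    up to order 5 must sit on the scaled zeros of the third Hermite polynomial, and its weights then
    leave mass 1/3 off zero. The prior charges the constrained alternative only with high
    probability. Both constraints concern the support size alone, because every non-zero coordinate
    has the same square and the null is the origin; a single Chebyshev bound therefore handles
    sparsity, where the slack [eta] is spent, and separation. The lowered variance must stay in the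
    allowed interval, so [x] may not exceed 1 - sigma_-^2 / sigma_+^2; this is where the ratio of
    the two levels enters the threshold on [n]. No Hermite series is summed: the second moment of
    the likelihood ratio per coordinate is a closed form in three exponentials and a square root,
    and the cancellation is checked on explicit Taylor polynomials. Total variation is avoided too:
    a pointwise quadratic inequality turns this second moment directly into a lower bound on the sum
    of errors. *)

Lemma expR_le_taylor (R : realType) (m : nat) (u : R) : `|u| <= 1 / 2 ->
  expR u <= \sum_(k < m) u ^+ k / k`!%:R + 2 * `|u| ^+ m.
Proof.
move=> u2.
have u0 := normr_ge0 u.
apply: limr_le; first exact: is_cvg_series_exp_coeff.
exists m => // N /= mN.
(* The subtracted term makes the induction close: a new term is at most [|u| ^+ N], hence at most
   [2 * |u| ^+ N - 2 * |u| ^+ N.+1] as [|u| <= 1 / 2]. *)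
suff: series (exp_coeff u) N <= \sum_(k < m) u ^+ k / k`!%:R +
    2 * `|u| ^+ m - 2 * `|u| ^+ N.
  by move/le_trans; apply; rewrite gerBl mulr_ge0// exprn_ge0.
rewrite -(subnKC mN); elim: (N - m)%N => [|j IH].
  by rewrite addn0 addrK /series /= /exp_coeff /= big_mkord.
rewrite addnS seriesSr exprS.
have : exp_coeff u (m + j)%N <= `|u| ^+ (m + j).
  rewrite /exp_coeff /=; apply: (le_trans (ler_norm _)).
  rewrite normrM normrX ler_piMr ?exprn_ge0// ger0_norm ?invr_ge0//.
  by rewrite invf_le1 ?ltr0n ?fact_gt0// ler1n fact_gt0.
have : 0 <= `|u| ^+ (m + j) by rewrite exprn_ge0.
move: IH; set a := series _ _; set b := exp_coeff _ _; set c := `|u| ^+ (m + j).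
move=> h1 h2 h3; nra.
Qed.

Lemma expR_le_taylor6 (R : realType) (u b : R) : `|u| <= b -> b <= 1 / 2 ->
  expR u <= 1 + u + u ^+ 2 / 2 + u ^+ 3 / 6 + u ^+ 4 / 24 + u ^+ 5 / 120 +
    2 * b ^+ 6.
Proof.
move=> ub b2; apply: (le_trans (expR_le_taylor 6 (le_trans ub b2))).
have /(_ 6) : forall n, `|u| ^+ n <= b ^+ n.
  by move=> n; apply: lerXn2r; rewrite ?nnegrE// (le_trans _ ub).
rewrite 6!big_ord_recr big_ord0 /= !factS fact0; move: (_ ^+ 6) (_ ^+ 6).
clear; move=> a c; lra.
Qed.

Lemma expR_le_taylor3 (R : realType) (u b : R) : `|u| <= b -> b <= 1 / 2 ->
  expR u <= 1 + u + u ^+ 2 / 2 + 2 * b ^+ 3.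
Proof.
move=> ub b2; apply: (le_trans (expR_le_taylor 3 (le_trans ub b2))).
have /(_ 3) : forall n, `|u| ^+ n <= b ^+ n.
  by move=> n; apply: lerXn2r; rewrite ?nnegrE// (le_trans _ ub).
rewrite 3!big_ord_recr big_ord0 /= !factS fact0; move: (_ ^+ 3) (_ ^+ 3).
clear; move=> a c; lra.
Qed.

Lemma expr_geometric_bounds (R : realType) (x : R) : 0 <= x -> x <= 1 / 10 ->
  forall j, 0 <= x ^+ j.+1 <= 1 / 10 * x ^+ j.
Proof.
by move=> x0 x1 j; rewrite exprn_ge0//= exprS ler_wpM2r// exprn_ge0.
Qed.

(* The polynomials p, q and v below are the expansions to order 5 of the exponents
   3x/(1+x), 3x/(1-x) and 3x^2/(2(1-x^2)). *)
Lemma expR_mehler_pos (R : realType) (x : R) : 0 <= x -> x <= 1 / 10 ->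
  forall p, p = 3 * (x - x ^+ 2 + x ^+ 3 - x ^+ 4 + x ^+ 5) ->
  expR (3 * x / (1 + x)) <=
  1 + p + p ^+ 2 / 2 + p ^+ 3 / 6 + p ^+ 4 / 24 + p ^+ 5 / 120 + 1458 * x ^+ 6.
Proof.
move=> x0 x1 p pE; have xx := expr_geometric_bounds x0 x1.
have p3 : 0 <= p <= 3 * x.
  by have := (xx 1, xx 2, xx 3, xx 4); rewrite pE => -[[[]]]; lra.
(* Truncation errs upwards: [p * (1 + x) = 3 * (x + x ^+ 6)]. In the next two lemmas the truncated
   series lies below the full one, which again is the right side since the exponent is negated. *)
apply: (@le_trans _ _ (expR p)).
  rewrite ler_expR ler_pdivrMr; last lra.
  have : 0 <= x ^+ 6 by rewrite exprn_ge0.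
  by rewrite pE; clear; lra.
rewrite (_ : 1458 * x ^+ 6 = 2 * (3 * x) ^+ 6); last by ring.
by apply: expR_le_taylor6; [rewrite ger0_norm|]; lra.
Qed.

Lemma expR_mehler_neg (R : realType) (x : R) : 0 <= x -> x <= 1 / 10 ->
  forall q, q = 3 * (x + x ^+ 2 + x ^+ 3 + x ^+ 4 + x ^+ 5) ->
  expR (- (3 * x / (1 - x))) <=
  1 - q + q ^+ 2 / 2 - q ^+ 3 / 6 + q ^+ 4 / 24 - q ^+ 5 / 120 + 8192 * x ^+ 6.
Proof.
move=> x0 x1 q qE; have xx := expr_geometric_bounds x0 x1.
have q4 : 0 <= q <= 4 * x.
  by have := (xx 1, xx 2, xx 3, xx 4); rewrite qE => -[[[]]]; lra.
apply: (@le_trans _ _ (expR (- q))).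
  rewrite ler_expR lerN2 ler_pdivlMr; last lra.
  have : 0 <= x ^+ 6 by rewrite exprn_ge0.
  by rewrite qE; clear; lra.
apply: (le_trans (@expR_le_taylor6 _ _ (4 * x) _ _)).
- by rewrite normrN ger0_norm; lra.
- lra.
by clear; lra.
Qed.

Lemma expR_mehler_even (R : realType) (x : R) : 0 <= x -> x <= 1 / 10 ->
  forall v, v = 3 / 2 * (x ^+ 2 + x ^+ 4) ->
  expR (- (3 * x ^+ 2 / (2 * (1 - x ^+ 2)))) <= 1 - v + v ^+ 2 / 2 + 16 * x ^+ 6.
Proof.
move=> x0 x1 v vE; have xx := expr_geometric_bounds x0 x1.
have v2 : 0 <= v <= 2 * x ^+ 2.
  by have := (xx 1, xx 2, xx 3); rewrite vE => -[[]]; lra.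
apply: (@le_trans _ _ (expR (- v))).
  rewrite ler_expR lerN2 ler_pdivlMr; last by have := xx 1; lra.
  have : 0 <= x ^+ 6 by rewrite exprn_ge0.
  by rewrite vE; clear; lra.
apply: (le_trans (@expR_le_taylor3 _ _ (2 * x ^+ 2) _ _)).
- by rewrite normrN ger0_norm; lra.
- have := xx 1; lra.
by clear; lra.
Qed.

(** Taylor polynomial of the square root with the whole tail absorbed by [x ^+ 6]; the bound 1/2
    makes it positive, so that squares can be compared, and later serves to divide by the root. *)
Lemma sqrt_1Bsqr_ge (R : realType) (x : R) : 0 <= x -> x <= 1 / 10 ->
  1 / 2 <= 1 - x ^+ 2 / 2 - x ^+ 4 / 8 - x ^+ 6 <= Num.sqrt (1 - x ^+ 2).
Proof.
move=> x0 x1; have xx := expr_geometric_bounds x0 x1.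
have s2 : 1 / 2 <= 1 - x ^+ 2 / 2 - x ^+ 4 / 8 - x ^+ 6.
  have := (xx 1, xx 2, xx 3, xx 4, xx 5) => -[[[[]]]]; lra.
rewrite s2 /= -(ger0_norm (x := _ - x ^+ 6)); last by apply: le_trans s2; lra.
rewrite -sqrtr_sqr ler_wsqrtr//.
have := (xx 5, xx 6, xx 7, xx 8, xx 9, xx 10, xx 11) => -[[[[[[]]]]]].
have : 0 <= x ^+ 6 by rewrite exprn_ge0.
clear; lra.
Qed.

(* One plus the chi-square divergence per coordinate, times sqrt (1 - x^2): see
   integral_mix_ratio_sqr. *)
Definition chisq_bracket (R : realType) (x : R) : R :=
  4 / 9 + 4 / 9 * expR (- (3 * x ^+ 2 / (2 * (1 - x ^+ 2))))
  + (expR (3 * x / (1 + x)) + expR (- (3 * x / (1 - x)))) / 18.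

(* All terms of degree less than 6 cancel; this is where moment matching enters. *)
Lemma chisq_bracket_le (R : realType) (x : R) : 0 <= x -> x <= 1 / 10 ->
  chisq_bracket x <= Num.sqrt (1 - x ^+ 2) * (1 + 20000 * x ^+ 6).
Proof.
move=> x0 x1; set s := Num.sqrt _.
have /andP[s2 sle] := sqrt_1Bsqr_ge x0 x1.
have x6 : 0 <= x ^+ 6 by rewrite exprn_ge0.
(* As [s >= 1 / 2], the constant 20000 in the product covers an additive 10000. *)
apply: (@le_trans _ _ (s + 10000 * x ^+ 6)); last first.
  have {sle} : 1 / 2 <= s by exact: le_trans sle.
  by move: s (x ^+ 6) x6; clear=> s y; nra.
apply: le_trans (_ : 1 - x ^+ 2 / 2 - x ^+ 4 / 8 - x ^+ 6 + 10000 * x ^+ 6 <= _);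
  last by rewrite lerD2r.
have ep := expR_mehler_pos x0 x1 erefl; have eq := expR_mehler_neg x0 x1 erefl.
have ev := expR_mehler_even x0 x1 erefl; move: ep eq ev; rewrite /chisq_bracket.
move: (expR _) (expR _) (expR _) => a b c /=.
(* The fifth powers of the quintic truncations reach degree 25. With each power an atom bounded by
   [x ^+ 6], the goal is linear; nothing is kept about lower powers, which must cancel
   identically. *)
have h n : (5 < n)%N -> 0 <= x ^+ n <= x ^+ 6.
  move=> n5; rewrite exprn_ge0//= -(subnKC n5) exprD ler_piMr// exprn_ile1//; lra.
have := (h 6 isT, h 7 isT, h 8 isT, h 9 isT, h 10 isT, h 11 isT,
  h 12 isT, h 13 isT, h 14 isT, h 15 isT, h 16 isT, h 17 isT,
  h 18 isT, h 19 isT, h 20 isT, h 21 isT, h 22 isT, h 23 isT, h 24 isT, h 25 isT).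
do 19 case.
clear; lra.
Qed.

(** * Integration against product laws *)

Lemma integral_iid_lawS d (T : measurableType d) (R : realType)
    (P : probability T R) n (f : n.+1.-tuple T -> \bar R) :
  measurable_fun setT f -> (forall t, 0 <= f t)%E ->
  (\int[iid_law P n.+1]_t f t =
   \int[P]_x \int[iid_law P n]_t f (tuple_cons (x, t)))%E.
Proof.
move=> mf f0; rewrite /= ge0_integral_pushforward//.
rewrite fubini_tonelli1//; last by move=> x; exact: f0.
exact: (measurableT_comp mf (@measurable_tuple_cons _ T n)).
Qed.

Lemma measurable_iid_fiber d (T : measurableType d) (R : realType)
    (P : probability T R) n (f : n.+1.-tuple T -> \bar R) :
  measurable_fun setT f -> (forall t, 0 <= f t)%E ->
  measurable_fun setT (fun x => (\int[iid_law P n]_t f (tuple_cons (x, t)))%E).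
Proof.
move=> mf f0.
apply: (@measurable_fun_fubini_tonelli_F _ _ _ _ _ (iid_law P n)
  (f \o @tuple_cons _ T n)) => [|x]; last exact: f0.
exact: (measurableT_comp mf (@measurable_tuple_cons _ T n)).
Qed.

Lemma measurable_prod_tnth d (T : measurableType d) (R : realType) n
    (g : 'I_n -> T -> R) : (forall i, measurable_fun setT (g i)) ->
  measurable_fun setT (fun t : n.-tuple T => \prod_(i < n) g i (tnth t i)).
Proof.
move=> mg; apply: measurable_prod => i _.
by apply: measurableT_comp => //; exact: measurable_tnth.
Qed.

(** The integral hypothesis says that [phi i] pushes [P] to the measure of density [g i] against
    [Q]. Tonelli peels off the head coordinate; [f] is arbitrary because the induction hypothesis is
    used with the head frozen. *)
Lemma integral_iid_law_density d (T : measurableType d) (R : realType)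
    (P Q : probability T R) n (phi : 'I_n -> T -> T) (g : 'I_n -> T -> R)
    (f : n.-tuple T -> \bar R) :
  (forall i, measurable_fun setT (phi i)) ->
  (forall i, measurable_fun setT (g i)) -> (forall i x, 0 <= g i x) ->
  (forall i (h : T -> \bar R), measurable_fun setT h -> (forall x, 0 <= h x)%E ->
    (\int[P]_x h (phi i x) = \int[Q]_x (h x * (g i x)%:E))%E) ->
  measurable_fun setT f -> (forall t, 0 <= f t)%E ->
  (\int[iid_law P n]_t f [tuple phi i (tnth t i) | i < n] =
   \int[iid_law Q n]_t (f t * (\prod_(i < n) g i (tnth t i))%:E))%E.
Proof.
elim: n phi g f => [|n IH] phi g f mphi mg g0 PQ mf f0.
  by apply: eq_integral => t _; rewrite big_ord0 mule1 [t]tuple0; congr f; exact: tuple0.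
have mphit m (psi : 'I_m -> T -> T) : (forall i, measurable_fun setT (psi i)) ->
    measurable_fun setT (fun t : m.-tuple T => [tuple psi i (tnth t i) | i < m]).
  move=> mpsi; apply/measurable_fun_tnthP => i.
  rewrite (_ : _ \o _ = fun t => psi i (tnth t i)); last first.
    by apply/funext => t /=; rewrite tnth_mktuple.
  by apply: measurableT_comp => //; exact: measurable_tnth.
have tupleE x (t : n.-tuple T) :
    [tuple phi i (tnth (tuple_cons (x, t)) i) | i < n.+1] =
    tuple_cons (phi ord0 x, [tuple phi (lift ord0 i) (tnth t i) | i < n]).
  apply: eq_from_tnth => i; rewrite tnth_mktuple.
  by case: (unliftP ord0 i) => [j|] ->; rewrite ?tnthS ?tnth0 ?tnth_mktuple.
have mfc x : measurable_fun setT (fun t : n.-tuple T => f (tuple_cons (x, t))).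
  have mc : measurable_fun setT (fun t : n.-tuple T => tuple_cons (x, t)).
    exact: (@measurable_cons _ _ _ _ (fun=> x) _ id).
  exact: measurableT_comp mf mc.
rewrite integral_iid_lawS//; last by exact: measurableT_comp mf (mphit _ _ _).
transitivity (\int[P]_x (\int[iid_law Q n]_t (f (tuple_cons (phi ord0 x, t)) *
    (\prod_(i < n) g (lift ord0 i) (tnth t i))%:E)))%E.
  apply: eq_integral => x _.
  rewrite -(IH (fun i => phi (lift ord0 i)) (fun i => g (lift ord0 i))
    (fun t => f (tuple_cons (phi ord0 x, t))))//.
    by apply: eq_integral => t _; rewrite tupleE.
  by move=> i h mh h0; exact: PQ.
have mp m (gg : 'I_m -> T -> R) : (forall i, measurable_fun setT (gg i)) ->
    measurable_fun setT (fun t : m.-tuple T => (\prod_(i < m) gg i (tnth t i))%:E).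
  by move=> mgg; apply/measurable_EFinP; exact: measurable_prod_tnth.
rewrite (PQ ord0 (fun x => \int[iid_law Q n]_t (f (tuple_cons (x, t)) *
   (\prod_(i < n) g (lift ord0 i) (tnth t i))%:E))%E)//; last 2 first.
- pose h (t : n.+1.-tuple T) := (f t *
    (\prod_(i < n) g (lift ord0 i) (tnth t (lift ord0 i)))%:E)%E.
  rewrite (_ : (fun x => _) =
      fun x => (\int[iid_law Q n]_t h (tuple_cons (x, t)))%E).
    apply: measurable_iid_fiber => [|t]; last by rewrite /h mule_ge0// lee_fin prodr_ge0.
    apply: emeasurable_funM => //; apply/measurable_EFinP.
    apply: measurable_prod => i _.
    by apply: measurableT_comp => //; exact: measurable_tnth.
  apply/funext => x; apply: eq_integral => t _; rewrite /h.
  by under [in RHS]eq_bigr do rewrite tnthS.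
- by move=> x; apply: integral_ge0 => t _; rewrite mule_ge0// lee_fin prodr_ge0.
rewrite integral_iid_lawS//; last 2 first.
- by apply: emeasurable_funM => //; exact: mp.
- by move=> t; rewrite mule_ge0// lee_fin prodr_ge0.
apply: eq_integral => x _; rewrite -ge0_integralZr//; last 3 first.
- by apply: emeasurable_funM => //; exact: (mp _ (fun i => g (lift ord0 i))).
- by move=> t _; rewrite mule_ge0// lee_fin prodr_ge0.
- by rewrite lee_fin.
apply: eq_integral => t _; rewrite big_ord_recl tnth0 EFinM.
rewrite [in RHS](muleC (g _ _)%:E) muleA.
by under [in RHS]eq_bigr do rewrite tnthS.
Qed.

Lemma integral_iid_law_prod d (T : measurableType d) (R : realType)
    (P : probability T R) n (g : 'I_n -> T -> R) :
  (forall i, measurable_fun setT (g i)) -> (forall i x, 0 <= g i x) ->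
  (\int[iid_law P n]_t (\prod_(i < n) g i (tnth t i))%:E =
   \prod_(i < n) \int[P]_x (g i x)%:E)%E.
Proof.
elim: n g => [|n IH] g mg g0.
  under eq_integral do rewrite big_ord0.
  by rewrite big_ord0 integral_cst//= mul1e diracT.
rewrite integral_iid_lawS; last 2 first.
- by apply/measurable_EFinP; exact: measurable_prod_tnth.
- by move=> t; rewrite lee_fin prodr_ge0.
rewrite big_ord_recl -IH// -ge0_integralZr//; last 3 first.
- exact/measurable_EFinP.
- by move=> x _; rewrite lee_fin.
- by apply: integral_ge0 => t _; rewrite lee_fin prodr_ge0.
apply: eq_integral => x _; rewrite -ge0_integralZl//; last 3 first.
- apply/measurable_EFinP.
  exact: (@measurable_prod_tnth _ _ _ _ (fun i => g (lift ord0 i))).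
- by move=> t _; rewrite lee_fin prodr_ge0.
- by rewrite lee_fin.
apply: eq_integral => t _; rewrite big_ord_recl tnth0 EFinM.
by under [in LHS]eq_bigr do rewrite tnthS.
Qed.

(** * Gaussian likelihood ratios *)

(** The Radon-Nikodym derivative and the density have equal integrals over all measurable sets, so
    they agree almost everywhere. *)
Lemma integral_normal_prob (R : realType) (m s : R) (f : R -> \bar R) :
  measurable_fun setT f -> (forall x, 0 <= f x)%E ->
  (\int[normal_prob m s]_x f x =
   \int[lebesgue_measure]_x (f x * (normal_pdf m s x)%:E))%E.
Proof.
move=> mf f0.
have dom : normal_prob m s `<< lebesgue_measure := normal_prob_dominates m s.
pose rn := Radon_Nikodym_SigmaFinite.f (normal_prob m s) lebesgue_measure.
have mpdf : measurable_fun setT (EFin \o normal_pdf m s).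
  by apply/measurable_EFinP; exact: measurable_normal_pdf.
have irn := Radon_Nikodym_SigmaFinite.f_integrable dom.
have mrn : measurable_fun setT rn := measurable_int _ irn.
have rn0 x : (0 <= rn x)%E by exact: Radon_Nikodym_SigmaFinite.f_ge0.
rewrite -(Radon_Nikodym_SigmaFinite.change_of_variables dom f0 measurableT mf).
apply: ge0_ae_eq_integral => //.
- exact: emeasurable_funM.
- exact: emeasurable_funM.
- by move=> x _; exact: mule_ge0.
- by move=> x _; rewrite mule_ge0// lee_fin normal_pdf_ge0.
apply: ae_eqe_mul2l.
apply: integral_ae_eq => // E _ mE.
by rewrite -Radon_Nikodym_SigmaFinite.f_integral.
Qed.

Lemma lebesgue_measure_shift (R : realType) (t : R) (A : set R) : measurable A ->
  pushforward lebesgue_measure (fun x : R => t + x : measurableTypeR R) A =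
  lebesgue_measure A.
Proof.
move=> mA.
have mt : measurable_fun setT (fun x : R => t + x : measurableTypeR R).
  exact: measurable_funD.
pose shift_mixin := isMeasurableFun.Build _ _ _ _ _ mt.
pose shift_pack : {mfun _ >-> _} :=
  HB.pack (fun x : R => t + x : measurableTypeR R) shift_mixin.
apply/esym/(@lebesgue_measure_unique _
  (pushforward lebesgue_measure shift_pack)) => //= _ [[a b]] _ <-.
rewrite /pushforward/= (_ : _ @^-1` _ = `]a - t, b - t]%classic); last first.
  by apply/seteqP; split=> x /=; rewrite !in_itv/=; lra.
rewrite !lebesgue_measure_itv/= !lte_fin ltrD2r.
by case: ifP => // _; rewrite -!EFinB; congr EFin; ring.
Qed.

Lemma integral_lebesgue_shift (R : realType) (t : R) (f : R -> \bar R) :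
  measurable_fun setT f -> (forall x, 0 <= f x)%E ->
  (\int[lebesgue_measure]_x f (t + x)%R = \int[lebesgue_measure]_x f x)%E.
Proof.
move=> mf f0.
have mt : measurable_fun setT (fun x : measurableTypeR R => t + x : measurableTypeR R).
  exact: measurable_funD.
have := @ge0_integral_pushforward _ _ _ _ R _ mt lebesgue_measure setT f.
rewrite preimage_setT => <-//.
by apply: eq_measure_integral => A mA _; exact: lebesgue_measure_shift.
Qed.

Definition normal_ratio (R : realType) (s r t y : R) : R :=
  normal_pdf t r y / normal_pdf 0 s y.

Lemma normal_ratio_ge0 (R : realType) (s r t y : R) : 0 <= normal_ratio s r t y.
Proof. by rewrite divr_ge0// normal_pdf_ge0. Qed.

Lemma normal_pdf_neq0 (R : realType) (m s x : R) : s != 0 -> normal_pdf m s x != 0.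
Proof.
by move=> s0; rewrite normal_pdfE// gt_eqF// mulr_gt0 ?expR_gt0// normal_peak_gt0.
Qed.

Lemma measurable_normal_ratio (R : realType) (s r t : R) : s != 0 ->
  measurable_fun setT (normal_ratio s r t).
Proof.
move=> s0; apply: measurable_funM; first exact: measurable_normal_pdf.
apply: continuous_measurable_fun => x.
by apply: cvgV; [exact: normal_pdf_neq0|exact: continuous_normal_pdf].
Qed.

(** The one-coordinate hypothesis of [integral_iid_law_density], with translation by [t] as the
    map. *)
Lemma integral_normal_ratio (R : realType) (s r t : R) (f : R -> \bar R) :
  s != 0 -> r != 0 -> measurable_fun setT f -> (forall x, 0 <= f x)%E ->
  (\int[normal_prob 0 r]_x f (t + x)%R =
   \int[normal_prob 0 s]_x (f x * (normal_ratio s r t x)%:E))%E.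
Proof.
move=> s0 r0 mf f0.
have mr : measurable_fun setT (EFin \o normal_ratio s r t).
  by apply/measurable_EFinP; exact: measurable_normal_ratio.
rewrite [RHS]integral_normal_prob; last 2 first.
- exact: emeasurable_funM.
- by move=> x; rewrite mule_ge0// lee_fin normal_ratio_ge0.
rewrite integral_normal_prob//; last first.
  by apply: measurableT_comp => //; exact: measurable_funD.
rewrite -[RHS](@integral_lebesgue_shift _ t); last 2 first.
- apply: emeasurable_funM; first exact: emeasurable_funM.
  by apply/measurable_EFinP; exact: measurable_normal_pdf.
- move=> x; rewrite mule_ge0 ?lee_fin ?normal_pdf_ge0//.
  by rewrite mule_ge0// lee_fin normal_ratio_ge0.
apply: eq_integral => x _; rewrite -muleA -EFinM /normal_ratio.
rewrite divfK ?normal_pdf_neq0//; congr (_ * _%:E)%E.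
by rewrite !normal_pdfE// /normal_fun subr0 [t + x]addrC addrK.
Qed.

Lemma normal_peakM (R : realType) (s z : R) : 0 < z ->
  normal_peak (s * z) = normal_peak s / z.
Proof.
move=> z0; rewrite /normal_peak exprMn -invfM; congr (_^-1).
rewrite (_ : s ^+ 2 * z ^+ 2 * pi *+ 2 = s ^+ 2 * pi *+ 2 * z ^+ 2); last by ring.
by rewrite sqrtrM ?sqrtr_sqr ?gtr0_norm// mulrn_wge0// mulr_ge0 ?sqr_ge0 ?pi_ge0.
Qed.

(* Inner product, in L^2(N(0, s^2)), of the likelihood ratios of N(t, s^2 (1 - x))
   and N(u, s^2 (1 - x)). *)
Definition mehler (R : realType) (s x t u : R) : R :=
  expR ((2 * t * u - x * (t ^+ 2 + u ^+ 2)) / (2 * s ^+ 2 * (1 - x ^+ 2))) /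
  Num.sqrt (1 - x ^+ 2).

(* Completing the square: the product of the two ratios against N(0, s^2) is
   again a multiple of a Gaussian density. *)
Lemma normal_ratioM (R : realType) (s x t u y : R) : 0 < s -> 0 <= x -> x < 1 ->
  normal_ratio s (s * Num.sqrt (1 - x)) t y *
  normal_ratio s (s * Num.sqrt (1 - x)) u y * normal_pdf 0 s y =
  mehler s x t u * normal_pdf ((t + u) / (1 + x))
    (s * (Num.sqrt (1 - x) / Num.sqrt (1 + x))) y.
Proof.
move=> s0 x0 x1; rewrite /mehler.
set z1 := Num.sqrt (1 - x); set z2 := Num.sqrt (1 + x).
have z10 : 0 < z1 by rewrite sqrtr_gt0; lra.
have z20 : 0 < z2 by rewrite sqrtr_gt0; lra.
have z1E : z1 ^+ 2 = 1 - x by rewrite sqr_sqrtr//; lra.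
have z2E : z2 ^+ 2 = 1 + x by rewrite sqr_sqrtr//; lra.
have -> : Num.sqrt (1 - x ^+ 2) = z1 * z2.
  by rewrite -sqrtrM ?subr_ge0 1?ltW//; congr Num.sqrt; ring.
have sn0 : s != 0 by rewrite gt_eqF.
rewrite /normal_ratio mulrA -mulrA mulVf ?normal_pdf_neq0// mulr1.
rewrite !normal_pdfE ?mulf_neq0 ?invr_eq0 ?(gt_eqF z10) ?(gt_eqF z20)//.
have k0 := normal_peak_gt0 sn0.
rewrite !normal_peakM ?divr_gt0// /normal_fun.
have key : expR (- (y - t) ^+ 2 / ((s * z1) ^+ 2 *+ 2)) *
    expR (- (y - u) ^+ 2 / ((s * z1) ^+ 2 *+ 2)) =
    expR (- (y - 0) ^+ 2 / (s ^+ 2 *+ 2)) *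
    (expR ((2 * t * u - x * (t ^+ 2 + u ^+ 2)) / (2 * s ^+ 2 * (1 - x ^+ 2))) *
    expR (- (y - (t + u) / (1 + x)) ^+ 2 / ((s * (z1 / z2)) ^+ 2 *+ 2))).
  rewrite -!expRD; congr expR; rewrite !exprMn exprVn z1E z2E.
  by field; rewrite sn0 /=; apply/and3P; split; apply: lt0r_neq0; nra.
have := expR_gt0 (- (y - 0) ^+ 2 / (s ^+ 2 *+ 2)); move: key.
move: (expR _) (expR _) (expR _) (expR _) (expR _) => G E D B A key D0.
transitivity (normal_peak s * (A * B) / (z1 ^+ 2 * D)).
  by field; rewrite !gt_eqF.
by rewrite key; field; rewrite !gt_eqF.
Qed.

(* Weights and nodes of the three-point Gauss-Hermite rule. *)
Definition gh_weight (R : realType) (i : 'I_3) : R :=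
  nth 0 [:: 2 / 3; 1 / 6; 1 / 6] i.

Definition gh_node (R : realType) (a : R) (i : 'I_3) : R :=
  nth 0 [:: 0; a; - a] i.

Lemma gh_weight_ge0 (R : realType) i : 0 <= gh_weight R i.
Proof. by case: i => -[|[|[|//]]] lti; rewrite /gh_weight /=; lra. Qed.

Lemma gh_weight_sum (R : realType) : \sum_i gh_weight R i = 1.
Proof. by rewrite 3!big_ord_recl big_ord0 /gh_weight /=; field. Qed.

(** In the unit [s * Num.sqrt x], [mehler] is the Mehler kernel, the sum of x^k He_k(b) He_k(c) /
    k!, and the nodes are the zeros of He_3. By symmetry the nine pairs give four values: both nodes
    zero (weight 4/9), exactly one zero (4/9), equal non-zero (1/18), opposite (1/18). *)
Lemma mehler_nodes_sum (R : realType) (s x : R) : 0 < s -> 0 <= x -> x < 1 ->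
  let a := s * Num.sqrt (3 * x) in
  \sum_i \sum_j gh_weight R i * gh_weight R j *
    mehler s x (gh_node a i) (gh_node a j) =
  chisq_bracket x / Num.sqrt (1 - x ^+ 2).
Proof.
move=> s0 x0 x1 a.
have aE : a ^+ 2 = s ^+ 2 * (3 * x).
  by rewrite exprMn sqr_sqrtr//; lra.
have sn : s != 0 by rewrite gt_eqF.
have xn : 1 - x != 0 /\ 1 + x != 0 by split; rewrite gt_eqF//; lra.
case: xn => x1n x2n.
have x3n : 1 - x ^+ 2 != 0 by rewrite (_ : _ - _ = (1 - x) * (1 + x)) ?mulf_neq0//; ring.
set S := Num.sqrt (1 - x ^+ 2).
have S0 : S != 0 by rewrite gt_eqF// sqrtr_gt0; nra.
have M00 : mehler s x 0 0 = S^-1.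
  by rewrite /mehler expr0n !(mulr0, addr0, subr0, mul0r) expR0 mul1r.
have M0 t : t ^+ 2 = s ^+ 2 * (3 * x) -> mehler s x 0 t =
    expR (- (3 * x ^+ 2 / (2 * (1 - x ^+ 2)))) / S.
  by move=> tE; rewrite /mehler tE; congr (expR _ / _); field; rewrite sn x3n.
have MC t u : mehler s x t u = mehler s x u t.
  by rewrite /mehler [t ^+ 2 + _]addrC [2 * t * u]mulrAC.
have Mt t : t ^+ 2 = s ^+ 2 * (3 * x) -> mehler s x t t =
    expR (3 * x / (1 + x)) / S.
  move=> tE; rewrite /mehler -[2 * t * t]mulrA -expr2 tE.
  by congr (expR _ / _); field; rewrite sn x3n x2n.
have MN t : t ^+ 2 = s ^+ 2 * (3 * x) -> mehler s x t (- t) =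
    expR (- (3 * x / (1 - x))) / S.
  move=> tE; rewrite /mehler mulrN -[2 * t * t]mulrA sqrrN -expr2 tE.
  by congr (expR _ / _); field; rewrite sn x3n x1n.
have naE : (- a) ^+ 2 = s ^+ 2 * (3 * x) by rewrite sqrrN.
rewrite 3!big_ord_recl big_ord0 !big_ord_recl !big_ord0 /gh_weight /gh_node /=.
rewrite (MC a 0) (MC (- a) 0) (MC (- a) a) M00 !M0// !Mt// MN// /chisq_bracket.
by field.
Qed.

Definition mix_ratio (R : realType) (s x y : R) : R :=
  \sum_i gh_weight R i * normal_ratio s (s * Num.sqrt (1 - x))
    (gh_node (s * Num.sqrt (3 * x)) i) y.

(** Expanding the square leaves nine products, each a [mehler] value times a Gaussian density of
    mass one by [normal_ratioM]. *)
Lemma integral_mix_ratio_sqr (R : realType) (s x : R) : 0 < s -> 0 <= x -> x < 1 ->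
  (\int[normal_prob 0 s]_y ((mix_ratio s x y) ^+ 2)%:E =
   (chisq_bracket x / Num.sqrt (1 - x ^+ 2))%:E)%E.
Proof.
move=> s0 x0 x1; set a := s * Num.sqrt (3 * x).
have sn : s != 0 by rewrite gt_eqF.
have mmix : measurable_fun setT (mix_ratio s x).
  apply: measurable_sum => i; apply: measurable_funM => //.
  exact: measurable_normal_ratio.
rewrite integral_normal_prob; last 2 first.
- by apply/measurable_EFinP; exact: measurable_funX.
- by move=> y; rewrite lee_fin sqr_ge0.
pose v := s * (Num.sqrt (1 - x) / Num.sqrt (1 + x)).
pose c (p : 'I_3 * 'I_3) := gh_weight R p.1 * gh_weight R p.2 *
  mehler s x (gh_node a p.1) (gh_node a p.2).
have c0 p : 0 <= c p.
  by rewrite mulr_ge0 ?mulr_ge0 ?gh_weight_ge0// divr_ge0// expR_ge0.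
pose m (p : 'I_3 * 'I_3) := (gh_node a p.1 + gh_node a p.2) / (1 + x).
transitivity (\int[lebesgue_measure]_y (\sum_p (c p * normal_pdf (m p) v y)%:E))%E.
  apply: eq_integral => y _; rewrite -EFinM sumEFin; congr EFin.
  rewrite expr2 big_distrlr pair_big /= mulr_suml; apply: eq_bigr => -[i j] _ /=.
  rewrite /c /m /v /= -[RHS]mulrA -(normal_ratioM _ _ _ s0 x0 x1) -/a.
  by ring.
rewrite ge0_integral_sum//; last 2 first.
- move=> p; apply/measurable_EFinP; apply: measurable_funM => //.
  exact: measurable_normal_pdf.
- by move=> p y _; rewrite lee_fin mulr_ge0// normal_pdf_ge0.
rewrite -(mehler_nodes_sum s0 x0 x1) pair_big -sumEFin; apply: eq_bigr => p _.
under eq_integral do rewrite EFinM.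
rewrite ge0_integralZl//; last 3 first.
- by apply/measurable_EFinP; exact: measurable_normal_pdf.
- by move=> y _; rewrite lee_fin normal_pdf_ge0.
- by rewrite lee_fin.
by rewrite integral_normal_pdf mule1.
Qed.

(** * The three-point prior *)

Lemma sum_ffun_prod (R : comNzRingType) (I J : finType) (w : J -> R) :
  \sum_j w j = 1 -> \sum_(f : {ffun I -> J}) \prod_i w (f i) = 1.
Proof.
by move=> w1; rewrite -(bigA_distr_bigA (fun=> w)) big1.
Qed.

(** Variance of a sum of independent centred variables: off-diagonal products contain a factor of
    mean zero. *)
Lemma second_moment_ffun (R : comNzRingType) (I J : finType) (w z : J -> R) :
  \sum_j w j = 1 -> \sum_j w j * z j = 0 ->
  \sum_(f : {ffun I -> J}) (\prod_i w (f i)) * (\sum_i z (f i)) ^+ 2 =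
  #|I|%:R * \sum_j w j * z j ^+ 2.
Proof.
move=> w1 wz0.
(* The two masks place [z] at coordinates [i] and [k], and twice when [i = k], so each cross moment
   is a product over all coordinates and sums over [f] by distributivity. *)
pose F (i k l : I) (j : J) : R :=
    w j * ((if l == i then z j else 1) * (if l == k then z j else 1)).
transitivity (\sum_i \sum_k \prod_(l : I) \sum_j F i k l j).
  under [RHS]eq_bigr do under eq_bigr do rewrite bigA_distr_bigA.
  under [RHS]eq_bigr do rewrite exchange_big.
  rewrite [RHS]exchange_big; apply: eq_bigr => f _.
  rewrite expr2 big_distrlr mulr_sumr; apply: eq_bigr => i _.
  rewrite mulr_sumr; apply: eq_bigr => k _; rewrite !big_split /=.
  by rewrite -!big_mkcond !big_pred1_eq.
rewrite mulr_natl -sumr_const; apply: eq_bigr => i _.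
rewrite (bigD1 i)//= [X in _ + X]big1 ?addr0 => [|k ki]; last first.
  rewrite (bigD1 i)//= [X in X * _](_ : _ = 0) ?mul0r//.
  by rewrite -[RHS]wz0; apply: eq_bigr => j _; rewrite /F eqxx eq_sym (negPf ki) mulr1.
rewrite (bigD1 i)//= [X in _ * X]big1 ?mulr1 => [|l li].
  by apply: eq_bigr => j _; rewrite /F eqxx expr2.
by rewrite -[RHS]w1; apply: eq_bigr => j _; rewrite /F (negPf li) !mulr1.
Qed.

(** Chebyshev's inequality for the support size, which under the prior is binomial with mean n/3 and
    variance 2n/9. *)
Lemma chebyshev_gh (R : realType) (n : nat) (delta : R) : 0 < delta ->
  \sum_(f : {ffun 'I_n -> 'I_3} |
      delta * n%:R < `|\sum_i (f i != ord0)%:R - n%:R / 3|)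
    \prod_i gh_weight R (f i) <= 2 / (9 * delta ^+ 2 * n%:R).
Proof.
move=> d0; pose z (j : 'I_3) : R := (j != ord0)%:R - 1 / 3.
have w1 := gh_weight_sum R.
have wz : \sum_j gh_weight R j * z j = 0.
  by rewrite !big_ord_recl big_ord0 /gh_weight /z /=; field.
have wz2 : \sum_j gh_weight R j * z j ^+ 2 = 2 / 9.
  by rewrite !big_ord_recl big_ord0 /gh_weight /z /=; field.
have w0 (f : {ffun 'I_n -> 'I_3}) : 0 <= \prod_i gh_weight R (f i).
  by apply: prodr_ge0 => i _; exact: gh_weight_ge0.
(* At [n = 0] the bound is a division by zero, equal to 0, and the strict inequality empties the
   sum. *)
have [->|n0] := eqVneq n 0%N.
  by rewrite big_pred0 ?mulr0 ?invr0 ?mulr0// => f; rewrite big_ord0 mul0r subrr normr0 ?mulr0 ltxx.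
have {}n0 : 0 < n%:R :> R by rewrite ltr0n lt0n.
have dn : 0 < (delta * n%:R) ^+ 2 by rewrite exprn_gt0// mulr_gt0.
rewrite (_ : 2 / _ = n%:R * (2 / 9) / (delta * n%:R) ^+ 2); last first.
  by field; rewrite !gt_eqF.
rewrite ler_pdivlMr// -[X in X%:R * (2 / 9)](card_ord n) -wz2.
rewrite -second_moment_ffun// mulr_suml big_mkcond /=; apply: ler_sum => f _.
have -> : \sum_i z (f i) = \sum_i (f i != ord0)%:R - n%:R / 3.
  by rewrite sumrB sumr_const card_ord -[X in _ - X]mulr_natl mul1r.
case: ifPn => [h|_]; last by rewrite mulr_ge0 ?sqr_ge0.
rewrite ler_wpM2l// -(real_normK (num_real (_ - _))) lerXn2r ?nnegrE ?normr_ge0 ?ltW//.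
exact: mulr_gt0.
Qed.

Lemma law_Y_density (R : realType) (n : nat) (s r : R) (theta : n.-tuple R)
    (A : set (n.-tuple (measurableTypeR R))) :
  s != 0 -> r != 0 -> measurable A ->
  (law_Y theta r A = \int[iid_law (normal_prob 0 s) n]_y
    ((\1_A y)%:E * (\prod_(i < n) normal_ratio s r (tnth theta i) (tnth y i))%:E))%E.
Proof.
move=> s0 r0 mA.
rewrite -(@integral_iid_law_density _ (measurableTypeR R) R (normal_prob 0 r) _ n
  (fun i x => tnth theta i + x) (fun i => normal_ratio s r (tnth theta i))
  (fun y => (\1_A y)%:E)).
- have mpre : measurable (add_tuple theta @^-1` A).
    by rewrite -[X in measurable X]setTI; exact: (measurable_add_tuple theta).
  transitivity (iid_law (normal_prob 0 r) n (add_tuple theta @^-1` A)); first by [].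
  rewrite -[add_tuple _ @^-1` _]setIT -integral_indic//.
- by move=> i; exact: measurable_funD.
- by move=> i; exact: measurable_normal_ratio.
- by move=> i x; exact: normal_ratio_ge0.
- by move=> i h mh h0; exact: integral_normal_ratio.
- exact/measurable_EFinP/measurable_indic.
- by move=> y; rewrite lee_fin.
Qed.

Lemma mix_ratio_ge0 (R : realType) (s x y : R) : 0 <= mix_ratio s x y.
Proof.
by apply: sumr_ge0 => i _; rewrite mulr_ge0 ?gh_weight_ge0 ?normal_ratio_ge0.
Qed.

Lemma measurable_mix_ratio (R : realType) (s x : R) : s != 0 ->
  measurable_fun setT (mix_ratio s x).
Proof.
move=> s0; apply: measurable_sum => i; apply: measurable_funM => //.
exact: measurable_normal_ratio.
Qed.

Definition gh_point (R : realType) (n : nat) (a : R) (f : {ffun 'I_n -> 'I_3}) :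
  n.-tuple R := [tuple gh_node a (f i) | i < n].

Definition gh_prior (R : realType) (n : nat) (f : {ffun 'I_n -> 'I_3}) : R :=
  \prod_i gh_weight R (f i).

Lemma gh_prior_ge0 (R : realType) n (f : {ffun 'I_n -> 'I_3}) : 0 <= gh_prior R f.
Proof. by apply: prodr_ge0 => i _; exact: gh_weight_ge0. Qed.

Lemma gh_prior_sum (R : realType) (n : nat) :
  \sum_(f : {ffun 'I_n -> 'I_3}) gh_prior R f = 1.
Proof. exact: sum_ffun_prod (gh_weight_sum R). Qed.

(** Prior and densities are both products, so distributivity turns the sum over [f] into a product
    over coordinates. *)
Lemma law_Y_mixture (R : realType) (n : nat) (s x : R)
    (A : set (n.-tuple (measurableTypeR R))) :
  0 < s -> 0 <= x -> x < 1 -> measurable A ->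
  (\sum_(f : {ffun 'I_n -> 'I_3}) (gh_prior R f)%:E *
     law_Y (gh_point (s * Num.sqrt (3 * x)) f) (s * Num.sqrt (1 - x)) A =
   \int[iid_law (normal_prob 0 s) n]_y
     (\1_A y * \prod_(i < n) mix_ratio s x (tnth y i))%:E)%E.
Proof.
move=> s0 x0 x1 mA; set a := s * Num.sqrt (3 * x); set r := s * Num.sqrt (1 - x).
have sn : s != 0 by rewrite gt_eqF.
have rn : r != 0 by rewrite mulf_neq0// gt_eqF// sqrtr_gt0; lra.
pose p f (y : n.-tuple (measurableTypeR R)) :=
  \prod_(i < n) normal_ratio s r (tnth (gh_point a f) i) (tnth y i).
have p0 f y : 0 <= p f y by apply: prodr_ge0 => i _; exact: normal_ratio_ge0.
have mp f : measurable_fun setT (fun y => ((\1_A y)%:E * (p f y)%:E)%E).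
  apply: emeasurable_funM; first exact/measurable_EFinP/measurable_indic.
  apply/measurable_EFinP.
  apply: (@measurable_prod_tnth _ (measurableTypeR R) R n
    (fun i => normal_ratio s r (tnth (gh_point a f) i))) => i.
  exact: measurable_normal_ratio.
have Ap0 f y : (0 <= (\1_A y)%:E * (p f y)%:E)%E by rewrite mule_ge0 ?lee_fin.
transitivity (\int[iid_law (normal_prob 0 s) n]_y
   \sum_f (gh_prior R f)%:E * ((\1_A y)%:E * (p f y)%:E))%E.
  rewrite ge0_integral_sum//; last 2 first.
  - by move=> f; exact: emeasurable_funM.
  - by move=> f y _; rewrite mule_ge0// lee_fin gh_prior_ge0.
  apply: eq_bigr => f _; rewrite ge0_integralZl//; last by rewrite lee_fin gh_prior_ge0.
  by rewrite (law_Y_density _ sn rn mA).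
apply: eq_integral => y _.
under eq_bigr do rewrite -!EFinM.
rewrite sumEFin bigA_distr_bigA /= mulr_sumr; congr EFin; apply: eq_bigr => f _.
rewrite mulrCA; congr (_ * _); rewrite -big_split/=; apply: eq_bigr => i _.
by rewrite tnth_mktuple.
Qed.

(* Integrate the pointwise bound 2 L <= 1_(~A) + 1_A L + L^2 + 1/4 for the
   likelihood ratio L of the mixture. *)
Lemma bayes_risk_ge (R : realType) (n : nat) (s x : R)
    (A : set (n.-tuple (measurableTypeR R))) :
  0 < s -> 0 <= x -> x < 1 -> measurable A ->
  (2%:E <= iid_law (normal_prob 0 s) n (~` A) +
    \sum_(f : {ffun 'I_n -> 'I_3}) (gh_prior R f)%:E *
     law_Y (gh_point (s * Num.sqrt (3 * x)) f) (s * Num.sqrt (1 - x)) A +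
    ((chisq_bracket x / Num.sqrt (1 - x ^+ 2)) ^+ n + 1 / 4)%:E)%E.
Proof.
move=> s0 x0 x1 mA; rewrite law_Y_mixture//.
have sn : s != 0 by rewrite gt_eqF.
pose L (y : n.-tuple (measurableTypeR R)) := \prod_(i < n) mix_ratio s x (tnth y i).
have L0 y : 0 <= L y by apply: prodr_ge0 => i _; exact: mix_ratio_ge0.
have mL : measurable_fun setT L.
  apply: (@measurable_prod_tnth _ (measurableTypeR R) R n (fun=> mix_ratio s x)) => i.
  exact: measurable_mix_ratio.
set Q := iid_law (normal_prob 0 s) n.
have intL : (\int[Q]_y (L y)%:E = 1)%E.
  transitivity (\int[Q]_y (\1_(setT : set (n.-tuple (measurableTypeR R))) y * L y)%:E)%E.
    by apply: eq_integral => y _; rewrite indicT mul1r.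
  rewrite -law_Y_mixture//.
  under eq_bigr do rewrite probability_setT mule1.
  by rewrite sumEFin gh_prior_sum.
have intL2 : (\int[Q]_y (L y ^+ 2)%:E =
    ((chisq_bracket x / Num.sqrt (1 - x ^+ 2)) ^+ n)%:E)%E.
  transitivity (\int[Q]_y (\prod_(i < n) (mix_ratio s x (tnth y i)) ^+ 2)%:E)%E.
    by apply: eq_integral => y _; rewrite /L prodrXl.
  rewrite (@integral_iid_law_prod _ (measurableTypeR R) R _ n
    (fun=> fun y => mix_ratio s x y ^+ 2)); last 2 first.
  - by move=> i; apply: measurable_funX; exact: measurable_mix_ratio.
  - by move=> i y; rewrite sqr_ge0.
  under eq_bigr do rewrite integral_mix_ratio_sqr//.
  by rewrite prodEFin prodr_const card_ord.
rewrite (EFinD (_ ^+ n)) -{}intL2 -[2%:E]mule1 -{}intL -ge0_integralZl//; last 2 first.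
- exact/measurable_EFinP.
- by move=> y _; rewrite lee_fin.
rewrite -(setIT (~` A)) -(integral_indic Q) //; last exact: measurableC.
have -> : (1 / 4 : R)%:E = (\int[Q]_y (1 / 4)%:E)%E.
  rewrite integral_cst// -[LHS]mule1; congr (_ * _)%E; exact/esym/(probability_setT Q).
have mA1 : measurable_fun setT (fun y : n.-tuple (measurableTypeR R) => (\1_(~` A) y)%:E : \bar R).
  by apply/measurable_EFinP/measurable_indic/measurableC.
have mA2 : measurable_fun setT (fun y => (\1_A y * L y)%:E).
  by apply/measurable_EFinP/measurable_funM => //; exact: measurable_indic.
have mL2 : measurable_fun setT (fun y => (L y ^+ 2)%:E).
  by apply/measurable_EFinP/measurable_funX.
have m4 : measurable_fun setT (fun _ : n.-tuple (measurableTypeR R) => (1 / 4 : R)%:E).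
  exact: measurable_cst.
have A0 y : 0 <= \1_A y * L y by rewrite mulr_ge0.
have q0 : 0 <= 1 / 4 :> R by lra.
rewrite -ge0_integralD//; last by move=> y _; exact: A0.
rewrite -ge0_integralD//; last by move=> y _; rewrite lee_fin sqr_ge0.
rewrite -ge0_integralD//; last 4 first.
- by move=> y _; rewrite adde_ge0 ?lee_fin//; exact: A0.
- exact: emeasurable_funD.
- by move=> y _; rewrite adde_ge0 ?lee_fin ?sqr_ge0.
- exact: emeasurable_funD.
apply: ge0_le_integral => //.
- by move=> y _; rewrite mule_ge0// lee_fin.
- by apply: emeasurable_funM => //; exact/measurable_EFinP.
- by apply: emeasurable_funD; exact: emeasurable_funD.
move=> y _; rewrite -EFinM -!EFinD lee_fin !indicE in_setC -/(L y).
(* On [A] the first square gives [L <= L ^+ 2 + 1 / 4]; off [A] the second gives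
   [2 * L <= 1 + L ^+ 2]. *)
have := sqr_ge0 (L y - 1 / 2); have := sqr_ge0 (L y - 1); rewrite !expr2.
move: (L y) => l; case: (y \in A) => /=; lra.
Qed.

(** * Lower bound on the risk *)

Lemma chisq_pow_le (R : realType) (n : nat) (x : R) : 0 <= x -> x <= 1 / 10 ->
  n%:R * (20000 * x ^+ 6) <= 1 / 5 ->
  (chisq_bracket x / Num.sqrt (1 - x ^+ 2)) ^+ n <= 5 / 4.
Proof.
move=> x0 x1 nx.
have S0 : 0 < Num.sqrt (1 - x ^+ 2) by rewrite sqrtr_gt0; nra.
have c0 : 0 <= chisq_bracket x.
  rewrite /chisq_bracket; move: (expR_ge0 (- (3 * x ^+ 2 / (2 * (1 - x ^+ 2)))))
    (expR_ge0 (3 * x / (1 + x))) (expR_ge0 (- (3 * x / (1 - x)))).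
  move: (expR _) (expR _) (expR _) => u v w; lra.
have h : chisq_bracket x / Num.sqrt (1 - x ^+ 2) <= expR (20000 * x ^+ 6).
  apply: le_trans (expR_ge1Dx _); rewrite ler_pdivrMr// mulrC.
  exact: chisq_bracket_le.
apply: (@le_trans _ _ (expR (20000 * x ^+ 6) ^+ n)).
  by rewrite lerXn2r ?nnegrE ?expR_ge0 ?divr_ge0 ?(ltW S0).
rewrite -expRM_natl; apply: (@le_trans _ _ (expR (1 / 5))); first by rewrite ler_expR.
(* Inverted, the claim is exp(-1/5) >= 4/5, an instance of exp(t) >= 1 + t. *)
rewrite -[1 / 5]opprK expRN -[5 / 4]invrK lef_pV2 ?posrE ?expR_gt0//.
by apply: le_trans (expR_ge1Dx _); lra.
Qed.

Lemma nneg_sup_ge0 (R : realType) (S : set (\bar R)) : (0 <= nneg_sup S)%E.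
Proof. by rewrite /nneg_sup le_max lexx. Qed.

Lemma nneg_sup_ubound (R : realType) (S : set (\bar R)) y :
  S y -> (y <= nneg_sup S)%E.
Proof. by move=> Sy; rewrite /nneg_sup le_max ereal_sup_ubound ?orbT. Qed.

Lemma law_Y_le_sup_risk (R : realType) n (sm sp : R) (Theta E : set (n.-tuple R))
    theta sigma : Theta theta -> sm <= sigma <= sp ->
  (law_Y theta sigma E <= sup_risk sm sp Theta E)%E.
Proof.
move=> Tt sb; apply: nneg_sup_ubound; exists (theta, sigma) => //.
Qed.

Lemma l0norm_gh_point (R : realType) n (a : R) (f : {ffun 'I_n -> 'I_3}) : a != 0 ->
  l0norm (gh_point a f) = (\sum_i (f i != ord0))%N.
Proof.
move=> a0; rewrite /l0norm -sum1_count big_tuple big_mkcond; apply: eq_bigr => i _.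
rewrite tnth_mktuple /gh_node; case: (f i) => -[|[|[|//]]] lti /=.
- by rewrite eqxx.
- by rewrite a0.
- by rewrite oppr_eq0 a0.
Qed.

Lemma B0_0 (R : realType) n (u : n.-tuple R) : B0 0 u -> forall i, tnth u i = 0.
Proof.
rewrite /B0 /l0norm /= leqn0 eqn0Ngt -has_count => /hasPn h i.
by apply/eqP; have := h _ (mem_tnth i u); rewrite negbK.
Qed.

Lemma d2_set_gh_point (R : realType) n (a : R) (f : {ffun 'I_n -> 'I_3}) :
  Num.sqrt (a ^+ 2 * \sum_i (f i != ord0)%:R) <= d2_set (gh_point a f) (B0 0).
Proof.
apply: lb_le_inf.
  exists (d2 (gh_point a f) [tuple 0 | _ < n]), [tuple 0 | _ < n] => //.
  rewrite /B0 /= /l0norm leqn0 eqn0Ngt -has_count; apply/hasPn => y /mapP[i _ ->].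
  by rewrite eqxx.
move=> _ [u /B0_0 u0 <-]; rewrite /d2 ler_wsqrtr// mulr_sumr ler_sum// => i _.
rewrite u0 subr0 tnth_mktuple /gh_node; case: (f i) => -[|[|[|//]]] lti /=.
- by rewrite mulr0 sqr_ge0.
- by rewrite mulr1.
- by rewrite sqrrN mulr1.
Qed.

Lemma gh_point_B0_sep (R : realType) n (a eta rho : R) (f : {ffun 'I_n -> 'I_3}) :
  a != 0 -> 0 < eta -> eta <= 2 / 3 -> rho ^+ 2 <= a ^+ 2 * n%:R / 6 ->
  `|\sum_i (f i != ord0)%:R - n%:R / 3| <= eta / 4 * n%:R ->
  B0_sep (0 + Num.truncn ((1 / 3 + eta) * n%:R)) 0 rho (gh_point a f).
Proof.
move=> a0 eta0 eta1 rhoE; set N := \sum_i _ => hN.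
have n0 : 0 <= n%:R :> R by [].
(* From [eta <= 2 / 3], 1/3 - eta/4 is at least 1/6; this is the 1/6 in the separation bound. *)
have {hN} [N1 N2] : n%:R / 6 <= N /\ N <= (1 / 3 + eta) * n%:R.
  by move: hN; rewrite ler_distl => /andP[h1 h2]; split; nra.
split.
  rewrite /B0 /= add0n l0norm_gh_point// truncn_ge_nat; last by nra.
  by rewrite natr_sum.
apply: le_trans (d2_set_gh_point a f); apply: le_trans (ler_norm _) _.
rewrite -sqrtr_sqr ler_wsqrtr//; apply: le_trans rhoE _.
by rewrite -mulrA ler_wpM2l// sqr_ge0.
Qed.

(** Translation by zero is measurable between the two structures and is the identity as a
    function. *)
Lemma measurable_tuple_measurableTypeR (R : realType) n (A : set (n.-tuple R)) :
  measurable A -> measurable (A : set (n.-tuple (measurableTypeR R))).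
Proof.
move=> mA; have := measurable_add_tuple [tuple (0 : R) | _ < n].
move=> /(_ measurableT A mA); rewrite setTI.
suff -> : add_tuple [tuple (0 : R) | _ < n] @^-1` A = A by [].
apply/seteqP; split=> y /=; rewrite (_ : add_tuple _ y = y)//;
  by apply: eq_from_tnth => i; rewrite !tnth_mktuple add0r.
Qed.

Lemma law_Y0 (R : realType) n (s : R) (A : set (n.-tuple R)) :
  law_Y [tuple (0 : R) | _ < n] s A = iid_law (normal_prob 0 s) n A.
Proof.
rewrite /law_Y /distribution /pushforward /=; congr (iid_law _ _ _).
apply/seteqP; split=> y /=; rewrite (_ : add_tuple _ y = y)//;
  by apply: eq_from_tnth => i; rewrite !tnth_mktuple add0r.
Qed.

(** Lets the prior leave the alternative: error probabilities are bounded by the supremum [v] at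
    good points and by 1 at bad ones. *)
Lemma sum_bad_good_le (R : realType) (I : finType) (w p : I -> R) (bad : pred I)
    (b v : R) : (forall i, 0 <= w i) -> \sum_i w i = 1 ->
  (forall i, 0 <= p i <= 1) -> \sum_(i | bad i) w i <= b ->
  0 <= v -> (forall i, ~~ bad i -> p i <= v) -> \sum_i w i * p i <= v + b.
Proof.
move=> w0 w1 p01 wb v0 pv; rewrite (bigID bad) /= addrC lerD//.
  rewrite -[leRHS]mulr1 -w1 mulr_sumr big_mkcond ler_sum// => i _.
  by case: ifPn => bi; rewrite ?mulr_ge0// mulrC ler_wpM2r// pv.
apply: le_trans wb; rewrite ler_sum// => i _.
by rewrite ler_piMr//; case/andP: (p01 i).
Qed.

(** The value 3/8 is 2 - 5/4 - 1/4 - 1/8: second moment of the likelihood ratio, constant of the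
    quadratic inequality, prior mass outside the alternative. The bound on [rho ^+ 2] is a sixth of
    [a ^+ 2 * n%:R], as [a ^+ 2 = 3 * s ^+ 2 * x]. *)
Lemma R_var_ge (R : realType) (n : nat) (sm s x eta rho : R)
    (T : {mfun n.-tuple R >-> bool}) :
  0 < s -> sm <= s * Num.sqrt (1 - x) -> 0 < x -> x <= 1 / 10 ->
  n%:R * (20000 * x ^+ 6) <= 1 / 5 ->
  0 < eta -> eta <= 2 / 3 -> 2 / (9 * (eta / 4) ^+ 2 * n%:R) <= 1 / 8 ->
  rho ^+ 2 <= s ^+ 2 * x * n%:R / 2 ->
  ((3 / 8)%:E <=
    R_var sm s T 0 (Num.truncn ((1 / 3 + eta) * n%:R)) rho)%E.
Proof.
move=> s0 smr x0 x1 nx eta0 eta1 cheb rhoE.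
set Delta := Num.truncn _; set r := s * _ in smr; pose a := s * Num.sqrt (3 * x).
have a0 : a != 0 by rewrite mulf_neq0 ?gt_eqF// sqrtr_gt0; lra.
have a2 : a ^+ 2 = 3 * (s ^+ 2 * x).
  by rewrite exprMn sqr_sqrtr; [ring | lra].
have rs : r <= s.
  rewrite -[leRHS]mulr1 ler_wpM2l ?(ltW s0)// -[leRHS]sqrtr1 ler_wsqrtr//; lra.
pose A : set (n.-tuple R) := [set y | T y = false].
have mA : measurable A.
  have mT : measurable_fun setT T by exact: measurable_funPT.
  have -> : A = setT `&` T @^-1` [set false] by rewrite setTI.
  exact: mT.
rewrite /R_var -/A.
have -> : [set y | T y = true] = ~` A.
  by apply/seteqP; split=> y; rewrite /A /=; case: (T y).
set S1 := sup_risk _ _ _ _; set S2 := sup_risk _ _ _ _.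
have S10 : (0 <= S1)%E by exact: nneg_sup_ge0.
have S20 : (0 <= S2)%E by exact: nneg_sup_ge0.
have Q1 : (iid_law (normal_prob 0 s) n (~` A) <= S1)%E.
  rewrite -law_Y0; apply: law_Y_le_sup_risk; last by rewrite lexx andbT (le_trans smr).
  rewrite /B0 /= leqn0 /l0norm eqn0Ngt -has_count.
  by apply/hasPn => y /mapP[i _ ->]; rewrite eqxx.
pose bad (f : {ffun 'I_n -> 'I_3}) :=
  eta / 4 * n%:R < `|\sum_i (f i != ord0)%:R - n%:R / 3|.
have good f : ~~ bad f -> (law_Y (gh_point a f) r A <= S2)%E.
  rewrite -leNgt => gf; apply: law_Y_le_sup_risk; last by rewrite smr.
  by apply: gh_point_B0_sep => //; rewrite a2; lra.
have := @bayes_risk_ge R n s x A s0 (ltW x0) _ (measurable_tuple_measurableTypeR mA).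
have {}x1' : x < 1 by lra.
move=> /(_ x1'); rewrite -/a -/r => bayes.
case: S2 S20 good => [v| |//] S20 good; last first.
  by rewrite addey ?leey// gt_eqF// (lt_le_trans _ S10).
pose p f := fine (law_Y (gh_point a f) r A).
have pE f : law_Y (gh_point a f) r A = (p f)%:E.
  by rewrite fineK// fin_num_measure.
have sumE : (\sum_(f : {ffun 'I_n -> 'I_3}) (gh_prior R f)%:E *
     law_Y (gh_point a f) r A <= (v + 1 / 8)%:E)%E.
  under eq_bigr do rewrite pE -EFinM.
  rewrite sumEFin lee_fin; apply: (@sum_bad_good_le _ _ _ _ bad).
  - exact: gh_prior_ge0.
  - exact: gh_prior_sum.
  - by move=> f; rewrite -!lee_fin -pE measure_ge0 probability_le1.
  - by apply: le_trans cheb; apply: chebyshev_gh; lra.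
  - by rewrite -lee_fin.
  - by move=> f gf; rewrite -lee_fin -pE; exact: good.
have pow := chisq_pow_le (ltW x0) x1 nx.
case: S1 S10 Q1 => [q| |//] S10 Q1; last by rewrite addye// leey.
have : (2%:E <= (q + (v + 1 / 8) + (5 / 4 + 1 / 4))%:E)%E.
  apply: le_trans bayes _; rewrite (EFinD (q + _)) leeD//; last by rewrite lee_fin lerD2r.
  by rewrite (EFinD q) leeD.
by rewrite -EFinD !lee_fin; lra.
Qed.

Lemma rho_star_var_sqr_ge (R : realType) (n k0 Delta : nat) (sm sp gamma rho : R) :
  0 < rho ->
  (forall T : {mfun n.-tuple R >-> bool}, (gamma%:E < R_var sm sp T k0 Delta rho)%E) ->
  ((rho ^+ 2)%:E <= rho_star_var n sm sp gamma k0 Delta ^+ 2)%E.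
Proof.
move=> rho0 RT.
have h : (rho%:E <= rho_star_var n sm sp gamma k0 Delta)%E.
  apply: le_ereal_inf_tmp => _ [T _ <-]; apply: nneg_sup_ubound.
  by exists rho => //; split.
by rewrite expe2 expr2 EFinM lee_pmul// lee_fin ltW.
Qed.

Lemma truncnS_le (R : realType) (y : R) (n : nat) :
  ((Num.truncn y).+1 <= n)%N -> y <= n%:R.
Proof.
by move=> h; apply: (le_trans (ltW (truncnS_gt y))); rewrite ler_nat.
Qed.

Theorem proposition5 (R : realType) (eta : R) (eta_gt0 : 0 < eta)
    (eta_le : eta <= 2 / 3) :
  exists c : R, 0 < c /\
  exists N : R -> nat,
  forall (sigma_m sigma_p gamma : R) (n : nat),
    0 < sigma_m -> sigma_m < sigma_p ->
    0 <= gamma -> gamma <= 1 / 4 ->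
    (N (sigma_p / sigma_m) <= n)%N ->
    ((c * sigma_p ^+ 2 * (n%:R `^ (5 / 6)))%:E <=
     rho_star_var n sigma_m sigma_p gamma 0
       (Num.truncn ((1 / 3 + eta) * n%:R)) ^+ 2)%E.
Proof.
(* The 1/20 is the 1/10 in [x] times the 1/2 in [rho ^+ 2]; [eta] enters only the threshold on
   [n]. *)
exists (1 / 20); split; first by lra.
(* The first summand ensures [x <= 1 - q ^- 2], that is, an admissible lowered variance; the second
   brings the Chebyshev bound 32 / (9 eta^2 n) down to 1/8. *)
exists (fun q => ((Num.truncn (((10 * (1 - q ^- 2)) ^+ 6)^-1)).+1 +
                  (Num.truncn (256 / (9 * eta ^+ 2))).+1)%N).
move=> sm sp gamma n sm0 smp gamma0 gamma4 Nn.
have sp0 : 0 < sp by exact: lt_trans smp.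
set q := sp / sm in Nn.
have {Nn} [n1 n2] : ((10 * (1 - q ^- 2)) ^+ 6)^-1 <= n%:R /\
    256 / (9 * eta ^+ 2) <= n%:R :> R.
  by split; apply: truncnS_le; apply: leq_trans Nn; rewrite ?leq_addr ?leq_addl.
have n0 : 0 < n%:R :> R.
  by apply: lt_le_trans n2; rewrite divr_gt0// mulr_gt0// exprn_gt0.
(* Dividing by 10 keeps [x] in the range of the expansions and gives
   [n%:R * (20000 * x ^+ 6) = 1 / 50]. *)
pose z : R := n%:R `^ (- (1 / 6)); pose x := z / 10.
have z0 : 0 < z by rewrite powR_gt0.
have z6 : z ^+ 6 = n%:R^-1.
  rewrite -powR_mulrn ?(ltW z0)// -powRrM (_ : - (1 / 6) * 6%:R = -1); last by field.
  by rewrite powR_inv1// ltW.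
have zn : z * n%:R = n%:R `^ (5 / 6).
  rewrite -[X in _ * X](@powRr1 _ n%:R) ?ltW// -powRD; last first.
    by rewrite (gt_eqF n0) implybT.
  by congr (_ `^ _); field.
have z1 : z <= 1.
  rewrite -(@ler_pXn2r _ 6) ?nnegrE ?(ltW z0)// expr1n z6 invf_le1// ler1n.
  by rewrite -(ltr0n R).
have qE : q ^- 2 = sm ^+ 2 / sp ^+ 2.
  by rewrite /q expr_div_n invfM invrK mulrC.
have q1 : 0 < 1 - q ^- 2.
  rewrite qE subr_gt0 ltr_pdivrMr ?exprn_gt0// mul1r ltrXn2r ?nnegrE//; exact: ltW.
have xq : x <= 1 - q ^- 2.
  rewrite /x ler_pdivrMr// mulrC -(@ler_pXn2r _ 6) ?nnegrE ?(ltW z0)//; last first.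
    by rewrite mulr_ge0// ltW.
  rewrite z6 -[leRHS]invrK lef_pV2 ?posrE// invr_gt0 exprn_gt0// mulr_gt0//.
pose rho := Num.sqrt (sp ^+ 2 * x * n%:R / 2).
have rho2 : rho ^+ 2 = sp ^+ 2 * x * n%:R / 2.
  by rewrite sqr_sqrtr// !mulr_ge0// ?sqr_ge0// ltW.
rewrite (_ : 1 / 20 * _ * _ = rho ^+ 2); last first.
  by rewrite rho2 -zn /x; field.
have x0 : 0 < x by rewrite divr_gt0.
apply: rho_star_var_sqr_ge.
  by rewrite sqrtr_gt0 !mulr_gt0// exprn_gt0.
move=> T; apply: (@lt_le_trans _ _ (3 / 8)%:E); first by rewrite lte_fin; lra.
apply: (@R_var_ge _ _ _ _ x) => //.
- rewrite -(@ler_pXn2r _ 2) ?nnegrE ?(ltW sm0)//; last by rewrite mulr_ge0// ltW.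
  have x1 : x <= 1 by apply: le_trans xq _; rewrite gerBl invr_ge0 sqr_ge0.
  rewrite exprMn sqr_sqrtr ?subr_ge0// mulrC -ler_pdivrMr ?exprn_gt0// -qE; lra.
- by rewrite /x; lra.
- have -> : n%:R * (20000 * x ^+ 6) = 1 / 50.
    by rewrite /x expr_div_n z6; field; rewrite gt_eqF.
  lra.
- have e2 : 0 < 9 * eta ^+ 2 by rewrite mulr_gt0// exprn_gt0.
  move: n2; rewrite ler_pdivrMr// => n2.
  rewrite ler_pdivrMr; last by rewrite !mulr_gt0// exprn_gt0// divr_gt0.
  by rewrite expr_div_n; lra.
- by rewrite rho2.
Qed.
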